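(* Let $k,\ell\ge 1$ and consider symmetric matrices $M,N\in\mathbb{R}^{(k+\ell)\times(k+\ell)}$ partitioned as $$M=\begin{bmatrix} M_{11} & M_{12}\\ M_{12}^\top & M_{22}\end{bmatrix},\qquad N=\begin{bmatrix} N_{11} & N_{12}\\ N_{12}^\top & N_{22}\end{bmatrix},$$ with $M_{11},N_{11}\in\mathbb{R}^{k\times k}$, $M_{12},N_{12}\in\mathbb{R}^{k\times \ell}$ and $M_{22},N_{22}\in\mathbb{R}^{\ell\times\ell}$. Assume that 1. $M_{12}=0$ and $M_{22}\le 0$; 2. $N_{22}\le 0$ and $N_{11}-N_{12}N_{22}^{+}N_{12}^\top=0$; 3. there exists $G\in\mathbb{R}^{\ell\times k}$ such that $M_{11}+G^\top M_{22}G>0$ and $N_{22}G=N_{12}^\top$. Then $$\begin{bmatrix} I\\ Z\end{bmatrix}^\top M\begin{bmatrix} I\\ Z\end{bmatrix}\ge 0\quad\text{for all } Z\in\mathbb{R}^{\ell\times k}\text{ such that }\begin{bmatrix} I\\ Z\end{bmatrix}^\top N\begin{bmatrix} I\\ Z\end{bmatrix}=0$$ if and only if there exists $\alpha\in\mathbb{R}$ such that $M-\alpha N\ge 0$.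
   Context: For a real symmetric matrix $S$, $S>0$ ($S\ge 0$, $S\le 0$) means that $S$ is positive definite (positive semidefinite, negative semidefinite). $X^{+}$ denotes the Moore–Penrose pseudo-inverse of $X$. $I$ is the identity matrix of appropriate size (here $k\times k$). *)

(* Defs.v *)
From mathcomp Require Import all_boot all_order all_algebra.
From mathcomp Require Import reals.
Set Implicit Arguments.
Unset Strict Implicit.
Unset Printing Implicit Defensive.
Import Order.TTheory GRing.Theory Num.Theory.
Local Open Scope ring_scope.

Section Definiteness.
Variables (R : realFieldType) (n : nat).

Lemma symmetricmxP (S : 'M[R]_n) : reflect (S^T = S) (S \is symmetricmx).
Proof.
by apply: (iffP (is_hermitianmxP _ _ _)); rewrite expr0 scale1r map_mx_id.
Qed.

Definition posdefmx (S : 'M[R]_n) : Prop :=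
  S \is symmetricmx /\ forall x : 'cV[R]_n, x != 0 -> 0 < (x^T *m S *m x) 0 0.

Definition psdmx (S : 'M[R]_n) : Prop :=
  S \is symmetricmx /\ forall x : 'cV[R]_n, 0 <= (x^T *m S *m x) 0 0.

Definition nsdmx (S : 'M[R]_n) : Prop :=
  S \is symmetricmx /\ forall x : 'cV[R]_n, (x^T *m S *m x) 0 0 <= 0.

End Definiteness.

Section MoorePenrose.
Variable R : realFieldType.

Definition penrose m n (A : 'M[R]_(m, n)) (X : 'M[R]_(n, m)) : bool :=
  [&& A *m X *m A == A, X *m A *m X == X,
      A *m X \is symmetricmx & X *m A \is symmetricmx].

Lemma penroseP m n (A : 'M[R]_(m, n)) (X : 'M[R]_(n, m)) :
  reflect [/\ A *m X *m A = A, X *m A *m X = X,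
              (A *m X)^T = A *m X & (X *m A)^T = X *m A]
          (penrose A X).
Proof.
apply: (iffP and4P).
  by move=> [/eqP ? /eqP ? /symmetricmxP ? /symmetricmxP].
by move=> [? ? ? ?]; split; first [exact/eqP | exact/symmetricmxP].
Qed.

Lemma mulmx_tr_eq0 m n (A : 'M[R]_(m, n)) : A *m A^T = 0 -> A = 0.
Proof.
move=> /matrixP A0; apply/matrixP => i j; rewrite mxE; apply/eqP.
have := A0 i i; rewrite !mxE => /eqP; rewrite psumr_eq0 => [|l _].
  by move=> /allP/(_ j (mem_index_enum _)); rewrite mxE mulf_eq0 orbb.
by rewrite mxE -expr2 sqr_ge0.
Qed.

Lemma row_free_gram_unit m n (A : 'M[R]_(m, n)) :
  row_free A -> A *m A^T \in unitmx.
Proof.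
move=> freeA; rewrite -row_free_unit -kermx_eq0; set K := kermx _.
have K0 : K *m (A *m A^T) = 0 by exact: mulmx_ker.
have /mulmx_tr_eq0 KA0 : (K *m A) *m (K *m A)^T = 0.
  by rewrite trmx_mul mulmxA -(mulmxA K) K0 mul0mx.
by apply/eqP/(row_free_inj freeA); rewrite KA0 mul0mx.
Qed.

Lemma penrose_full_rank_factor m n r (C : 'M[R]_(m, r)) (F : 'M[R]_(r, n)) :
  row_full C -> row_free F -> exists X, penrose (C *m F) X.
Proof.
move=> fullC freeF.
have uF : F *m F^T \in unitmx by exact: row_free_gram_unit.
have uC : C^T *m C \in unitmx.
  rewrite -{2}[C]trmxK; apply: row_free_gram_unit.
  by rewrite /row_free mxrank_tr.
pose Fi := F^T *m invmx (F *m F^T); pose Ci := invmx (C^T *m C) *m C^T.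
have FFi : F *m Fi = 1%:M by rewrite mulmxA mulmxV.
have CiC : Ci *m C = 1%:M by rewrite -mulmxA mulVmx.
have AX : C *m F *m (Fi *m Ci) = C *m Ci.
  by rewrite -mulmxA (mulmxA F) FFi mul1mx.
have XA : Fi *m Ci *m (C *m F) = Fi *m F.
  by rewrite -mulmxA (mulmxA Ci) CiC mul1mx.
exists (Fi *m Ci); apply/penroseP; split.
- by rewrite AX -mulmxA (mulmxA Ci) CiC mul1mx.
- by rewrite XA -mulmxA (mulmxA F) FFi mul1mx.
- by rewrite AX /Ci !trmx_mul trmxK trmx_inv trmx_mul trmxK mulmxA.
- by rewrite XA /Fi !trmx_mul trmxK trmx_inv trmx_mul trmxK mulmxA.
Qed.

Lemma penrose_exists m n (A : 'M[R]_(m, n)) : exists X, penrose A X.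
Proof.
have := penrose_full_rank_factor (col_base_full A) (row_base_free A).
by rewrite mulmx_base.
Qed.

Lemma penrose_unique m n (A : 'M[R]_(m, n)) X Y :
  penrose A X -> penrose A Y -> X = Y.
Proof.
move=> /penroseP[AXA XAX AXt XAt] /penroseP[AYA YAY AYt YAt].
have EAX : A *m X = A *m Y.
  rewrite -AXt -{1}AYA -(mulmxA _ A X) trmx_mul AXt AYt.
  by rewrite mulmxA AXA.
have EXA : X *m A = Y *m A.
  rewrite -XAt -{1}AYA -mulmxA mulmxA trmx_mul YAt XAt.
  by rewrite -mulmxA (mulmxA A) AXA.
by rewrite -XAX -YAY EXA -!mulmxA EAX.
Qed.

(* The Moore-Penrose pseudo-inverse; [pinvmx] is only a generalized inverse. *)
Definition mpinv m n (A : 'M[R]_(m, n)) : 'M[R]_(n, m) :=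
  xchoose (penrose_exists A).

Lemma mpinvP m n (A : 'M[R]_(m, n)) : penrose A (mpinv A).
Proof. exact: xchooseP. Qed.

End MoorePenrose.

(* Main.v *)
Require Import Defs.
From mathcomp Require Import all_boot all_order all_algebra.
From mathcomp Require Import reals.
From mathcomp Require Import lra.
Set Implicit Arguments.
Unset Strict Implicit.
Unset Printing Implicit Defensive.
Import Order.TTheory GRing.Theory Num.Theory.
Local Open Scope ring_scope.

(* With G as in the third assumption, N = [G I]^T N22 [G I], so every Z = W - G
   with N22 W = 0 satisfies the constraint.  Letting W go to infinity along a
   kernel direction of N22 shows that ker N22 is contained in ker M22.  In the
   coordinates (x, u) with u = G x + y, the form of M - alpha N is
     x^T P x - 2 u^T M22 G x + u^T M22 u - alpha u^T N22 u
   where P = M11 + G^T M22 G > 0.  Completing the square in x leaves the form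
   -alpha N22 - Q in u, where Q = M22 G P^-1 G^T M22 - M22 vanishes on ker N22;
   a large alpha makes it positive semidefinite. *)

Section BilinearForms.
Variable R : realFieldType.

Definition bform m n (S : 'M[R]_(m, n)) (x : 'cV[R]_m) (y : 'cV[R]_n) : R :=
  (x^T *m S *m y) 0 0.

Lemma bformDl m n (S : 'M[R]_(m, n)) x1 x2 y :
  bform S (x1 + x2) y = bform S x1 y + bform S x2 y.
Proof. by rewrite /bform linearD !mulmxDl mxE. Qed.

Lemma bformDr m n (S : 'M[R]_(m, n)) x y1 y2 :
  bform S x (y1 + y2) = bform S x y1 + bform S x y2.
Proof. by rewrite /bform mulmxDr mxE. Qed.

Lemma bformZl m n (S : 'M[R]_(m, n)) a x y :
  bform S (a *: x) y = a * bform S x y.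
Proof. by rewrite /bform linearZ /= -!scalemxAl mxE. Qed.

Lemma bformZr m n (S : 'M[R]_(m, n)) a x y :
  bform S x (a *: y) = a * bform S x y.
Proof. by rewrite /bform -scalemxAr mxE. Qed.

Lemma bformNl m n (S : 'M[R]_(m, n)) x y : bform S (- x) y = - bform S x y.
Proof. by rewrite -scaleN1r bformZl mulN1r. Qed.

Lemma bformNr m n (S : 'M[R]_(m, n)) x y : bform S x (- y) = - bform S x y.
Proof. by rewrite -scaleN1r bformZr mulN1r. Qed.

Lemma bformDm m n (S T : 'M[R]_(m, n)) x y :
  bform (S + T) x y = bform S x y + bform T x y.
Proof. by rewrite /bform mulmxDr mulmxDl mxE. Qed.

Lemma bformZm m n a (S : 'M[R]_(m, n)) x y :
  bform (a *: S) x y = a * bform S x y.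
Proof. by rewrite /bform -scalemxAr -scalemxAl mxE. Qed.

Lemma bformNm m n (S : 'M[R]_(m, n)) x y : bform (- S) x y = - bform S x y.
Proof. by rewrite -scaleN1r bformZm mulN1r. Qed.

Lemma bform_tr m n (S : 'M[R]_(m, n)) x y : bform S^T y x = bform S x y.
Proof.
by rewrite /bform -[x^T *m S *m y]trmxK [RHS]mxE !trmx_mul trmxK mulmxA.
Qed.

Lemma bformC n (S : 'M[R]_n) x y : S^T = S -> bform S x y = bform S y x.
Proof. by move=> S_sym; rewrite -bform_tr S_sym. Qed.

Lemma bform_mull m n p (A : 'M[R]_(p, m)) (S : 'M[R]_(p, n)) x y :
  bform (A^T *m S) x y = bform S (A *m x) y.
Proof. by rewrite /bform trmx_mul !mulmxA. Qed.

Lemma bform_mulr m n p (S : 'M[R]_(m, p)) (B : 'M[R]_(p, n)) x y :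
  bform (S *m B) x y = bform S x (B *m y).
Proof. by rewrite /bform !mulmxA. Qed.

Lemma bform_sum m n (S : 'M[R]_(m, n)) x y :
  bform S x y = \sum_i \sum_j x i 0 * S i j * y j 0.
Proof.
rewrite /bform mxE exchange_big; apply: eq_bigr => j _ /=.
by rewrite mxE mulr_suml; apply: eq_bigr => i _; rewrite mxE.
Qed.

Lemma bform1 n (x : 'cV[R]_n) : bform 1%:M x x = \sum_i x i 0 ^+ 2.
Proof.
by rewrite /bform mulmx1 mxE; apply: eq_bigr => i _; rewrite mxE expr2.
Qed.

Lemma bform1_ge0 n (x : 'cV[R]_n) : 0 <= bform 1%:M x x.
Proof. by rewrite bform1 sumr_ge0 // => i _; exact: sqr_ge0. Qed.

Lemma bform1_eq0 n (x : 'cV[R]_n) : bform 1%:M x x = 0 -> x = 0.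
Proof.
move=> x0; apply: trmx_inj; rewrite trmx0; apply: mulmx_tr_eq0.
by rewrite trmxK [LHS]mx11_scalar -[x^T]mulmx1 [_ 0 0]x0 raddf0.
Qed.

Lemma sqr_le_bform1 n (x : 'cV[R]_n) i : x i 0 ^+ 2 <= bform 1%:M x x.
Proof.
rewrite bform1 (bigD1 i) //= lerDl sumr_ge0 // => j _; exact: sqr_ge0.
Qed.

(** Each product of two coordinates is at most the squared norm in absolute value, so the sum of the
    absolute entries is a bound. The added 1 keeps the constant positive, hence invertible. *)
Lemma bform_bounded n (S : 'M[R]_n) :
  exists2 c, 0 < c & forall x, bform S x x <= c * bform 1%:M x x.
Proof.
exists (1 + \sum_i \sum_j `|S i j|).
  by rewrite ltr_wpDr ?ltr01 // !sumr_ge0 // => i _; rewrite sumr_ge0.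
move=> x; rewrite mulrDl mul1r ler_wpDl ?bform1_ge0 // bform_sum mulr_suml.
apply: ler_sum => i _; rewrite mulr_suml; apply: ler_sum => j _.
rewrite mulrAC mulrC (le_trans (ler_norm _)) // normrM ler_wpM2l //.
have := sqr_le_bform1 x i; have := sqr_le_bform1 x j.
move: (x i 0) (x j 0) (bform _ _ _) => a b d bd ad.
by rewrite ler_norml; apply/andP; split; nra.
Qed.

(* Evaluating the form at [x - t A x] with [t] the inverse of an upper bound of
   [A] replaces the spectral theorem. *)
Lemma psd_sqr_bounded n (A : 'M[R]_n) : psdmx A ->
  exists2 c, 0 < c & forall x, bform 1%:M (A *m x) (A *m x) <= c * bform A x x.
Proof.
move=> [/symmetricmxP A_sym A_ge0]; have [c c_gt0 Ac] := bform_bounded A.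
exists c => // x; have := A_ge0 (x - c^-1 *: (A *m x)).
rewrite -/(bform _ _ _) bformDl !bformDr !bformNl !bformNr !bformZl !bformZr.
have Axx : bform A x (A *m x) = bform 1%:M (A *m x) (A *m x).
  by rewrite -{1}A_sym -[A^T]mulmx1 bform_mull.
rewrite (bformC _ x A_sym) Axx; have := Ac (A *m x).
move: (bform 1%:M _ _) (bform A x x) (bform A _ _) => d a b bcd.
have ci_gt0 : 0 < c^-1 by rewrite invr_gt0.
have cci : c * c^-1 = 1 by rewrite divff // gt_eqF.
move: (c^-1) ci_gt0 cci => ci ci_gt0 cci h.
(* [h] says that [a - 2 d / c + b / c ^+ 2] is nonnegative; [b <= c * d] bounds the last term by
   [d / c], which leaves [d / c <= a]. *)
have h1 : ci * (ci * b) <= ci * d.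
  rewrite ler_pM2l //; apply: le_trans (ler_wpM2l (ltW ci_gt0) bcd) _.
  by rewrite mulrA (mulrC ci) cci mul1r.
have h2 : ci * d <= a by lra.
by rewrite -[d]mul1r -cci -mulrA ler_pM2l.
Qed.

Lemma psd_ker n (A : 'M[R]_n) x : psdmx A -> bform A x x = 0 -> A *m x = 0.
Proof.
move=> /psd_sqr_bounded[c _ Ac] Ax0; apply: bform1_eq0.
by apply/eqP; rewrite eq_le bform1_ge0 andbT (le_trans (Ac x)) // Ax0 mulr0.
Qed.

Lemma posdef_unitmx n (P : 'M[R]_n) : posdefmx P -> P \in unitmx.
Proof.
move=> [/symmetricmxP P_sym P_gt0].
rewrite -row_free_unit -kermx_eq0; apply/eqP/row_matrixP => i.
rewrite row0; set v := row i _; apply/eqP/negPn/negP => v_neq0.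
have vP : v *m P = 0 by apply: sub_kermxP; exact: row_sub.
have := P_gt0 v^T; rewrite trmxK vP mul0mx mxE ltxx => /(_ _)/negP[] //.
by rewrite -trmx_eq0 trmxK.
Qed.

(* The kernel inclusion gives [Q = A *m K *m A], so the form of [Q] at [x] is
   bounded by the squared norm of [A *m x]. *)
Lemma psd_dominates n (A Q : 'M[R]_n) : psdmx A -> Q^T = Q ->
    (forall x : 'cV_n, A *m x = 0 -> Q *m x = 0) ->
  exists c, forall x, bform Q x x <= c * bform A x x.
Proof.
move=> psdA Q_sym kerAQ; have [/symmetricmxP A_sym _] := psdA.
have /penroseP[AXA _ _ _] := mpinvP A; set X := mpinv A in AXA.
(* Since [A *m X *m A = A], the columns of [1 - X *m A] lie in the kernel of [A], hence in that of
   [Q]. *)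
have QE : Q = Q *m X *m A.
  apply/eqP; rewrite -subr_eq0 -mulmxA -[X in X - _]mulmx1 -mulmxBr.
  apply/eqP/trmx_inj/row_matrixP => i; rewrite -tr_col trmx0 row0 colE -mulmxA.
  by rewrite kerAQ ?trmx0 // mulmxA mulmxBr mulmx1 mulmxA AXA subrr mul0mx.
have QAKA : Q = A^T *m (X^T *m Q *m X) *m A.
  by rewrite {1}QE -{1}Q_sym {1}QE !trmx_mul Q_sym !mulmxA.
have [c c_gt0 Kc] := bform_bounded (X^T *m Q *m X).
have [d d_gt0 Ad] := psd_sqr_bounded psdA.
exists (c * d) => x; rewrite QAKA bform_mulr bform_mull.
by rewrite (le_trans (Kc _)) // -mulrA ler_pM2l.
Qed.

(** Averaging the values at [t] and [- t] removes the linear term. If [q < 0], then [p + s * q = 0]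
    for [s = p / - q], and [(1 + s) ^+ 2 > s] makes the value at [1 + s] negative. *)
Lemma real_quadratic_lead_ge0 (p b q : R) :
  (forall t : R, 0 <= p + t * b + t ^+ 2 * q) -> 0 <= q.
Proof.
move=> h; rewrite leNgt; apply/negP => q_lt0.
have p_ge0 : 0 <= p by have := h 0; rewrite mul0r expr0n mul0r !addr0.
have even t : 0 <= p + t ^+ 2 * q.
  by have := h t; have := h (- t); rewrite sqrrN mulNr; lra.
pose s := p / - q.
have s_ge0 : 0 <= s by rewrite divr_ge0 // oppr_ge0 ltW.
have sq : s * q = - p by rewrite /s invrN mulrN mulNr mulfVK // lt_eqF.
by have := even (1 + s); rewrite sqrrD; nra.
Qed.

End BilinearForms.

Theorem theorem1 (R : realType) (k l : nat) (k_ge1 : (1 <= k)%N)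
    (l_ge1 : (1 <= l)%N)
    (M N : 'M[R]_(k + l))
    (M11 N11 : 'M[R]_k) (M12 N12 : 'M[R]_(k, l)) (M22 N22 : 'M[R]_l)
    (M_sym : M \is symmetricmx) (N_sym : N \is symmetricmx)
    (M_blocks : M = block_mx M11 M12 M12^T M22)
    (N_blocks : N = block_mx N11 N12 N12^T N22)
    (M12_eq0 : M12 = 0) (M22_le0 : nsdmx M22)
    (N22_le0 : nsdmx N22)
    (N_schur : N11 - N12 *m mpinv N22 *m N12^T = 0)
    (G_exists : exists G : 'M[R]_(l, k),
       posdefmx (M11 + G^T *m M22 *m G) /\ N22 *m G = N12^T) :
  (forall Z : 'M[R]_(l, k),
     (col_mx 1%:M Z)^T *m N *m col_mx 1%:M Z = 0 ->
     psdmx ((col_mx 1%:M Z)^T *m M *m col_mx 1%:M Z))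
  <-> (exists alpha : R, psdmx (M - alpha *: N)).
Proof.
have /symmetricmxP MT := M_sym; have /symmetricmxP NT := N_sym.
have [/symmetricmxP M22T M22_form] := M22_le0.
have [/symmetricmxP N22T N22_form] := N22_le0.
case: G_exists => G [P_gt0 N22G]; set P := _ + _ in P_gt0.
have [/symmetricmxP PT P_form] := P_gt0.
pose E := row_mx G (1%:M : 'M[R]_l).
have N12E : N12 = G^T *m N22 by rewrite -[N12]trmxK -N22G trmx_mul N22T.
have N11E : N11 = G^T *m N22 *m G.
  have /penroseP[AXA _ _ _] := mpinvP N22.
  move/eqP: N_schur; rewrite subr_eq0 -N22G N12E => /eqP ->.
  by rewrite !mulmxA -2!(mulmxA G^T) AXA.
have NE : N = E^T *m N22 *m E.
  rewrite N_blocks /E tr_row_mx trmx1 mul_col_mx mul_col_row mul1mx !mulmx1.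
  by rewrite -N11E -N12E N22G.
have M_form x y : bform M (col_mx x y) (col_mx x y)
    = bform M11 x x + bform M22 y y.
  rewrite M_blocks M12_eq0 /bform tr_col_mx trmx0 mul_row_block.
  by rewrite !mulmx0 addr0 add0r mul_row_col mxE.
have N_form x y : bform N (col_mx x y) (col_mx x y)
    = bform N22 (G *m x + y) (G *m x + y).
  by rewrite NE bform_mulr bform_mull /E mul_row_col mul1mx.
have P_formE x : bform P x x
    = bform M11 x x + bform M22 (G *m x) (G *m x).
  by rewrite /P bformDm bform_mulr bform_mull.
(* The converse is direct: on the constraint set the compression of [alpha *: N] vanishes, so those
   of [M] and [M - alpha *: N] agree. *)
split=> [H|[alpha [_ psd]] Z ZN0]; last first.
  split; first by apply/symmetricmxP; rewrite !trmx_mul trmxK MT mulmxA.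
  set C := col_mx _ _ in ZN0 *; move=> x; have := psd (C *m x).
  rewrite -!/(bform _ _ _) -bform_mull -bform_mulr.
  rewrite mulmxBr mulmxBl -scalemxAr -scalemxAl ZN0.
  by rewrite scaler0 subr0.
have kerNM (w : 'cV[R]_l) : N22 *m w = 0 -> M22 *m w = 0.
  move=> N22w; apply/eqP; rewrite -oppr_eq0 -mulNmx; apply/eqP.
  have psdM : psdmx (- M22).
    split; first by apply/symmetricmxP; rewrite linearN /= M22T.
    by move=> x; rewrite -/(bform _ _ _) bformNm oppr_ge0; exact: M22_form.
  (* As [M22] is negative semidefinite, only [0 <= bform M22 w w] is left. It is the leading
     coefficient in [t] of the form of [M] at [col_mx e (Z *m e)]. *)
  apply: psd_ker psdM _; apply/eqP; rewrite bformNm oppr_eq0 eq_le M22_form /=.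
  pose e : 'cV[R]_k := delta_mx (Ordinal k_ge1) 0.
  pose b := bform M22 w (G *m e).
  apply: (@real_quadratic_lead_ge0 _ (bform P e e) (- (2 * b))) => t.
  (* The rank-one term sends the unit vector [e] to [t *: w] and is killed by [N22]. *)
  pose Z := t *: (w *m e^T) - G.
  have ee : e^T *m e = 1%:M.
    by rewrite /e trmx_delta mul_delta_mx [LHS]mx11_scalar mxE !eqxx.
  have Ze : Z *m e = t *: w - G *m e.
    by rewrite /Z mulmxBl -scalemxAl -mulmxA ee mulmx1.
  have [|_ /(_ e)] := H Z.
    rewrite NE !mulmxA -trmx_mul -mulmxA -mulmxA /E mul_row_col mulmx1 mul1mx.
    rewrite /Z addrCA subrr addr0 -scalemxAr mulmxA N22w mul0mx scaler0.
    by rewrite mulmx0.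
  rewrite -/(bform _ _ _) bform_mulr bform_mull mul_col_mx mul1mx M_form.
  rewrite Ze P_formE bformDl !bformDr !bformNl !bformNr !bformZl !bformZr.
  rewrite (bformC (G *m e) w M22T) -/b; lra.
have P_unit := posdef_unitmx P_gt0.
(* For fixed [u], the form is minimal in [x] at [x = L *m u]; its part in [u] is then that of
   [- Q - alpha *: N22]. *)
pose L := invmx P *m G^T *m M22.
pose Q := M22 *m G *m L - M22.
have PLE : P *m L = G^T *m M22 by rewrite /L -mulmxA mulKVmx.
have QT : Q^T = Q.
  rewrite /Q /L linearB /= !trmx_mul trmxK trmx_inv PT M22T.
  by rewrite !mulmxA.
have kerNQ (w : 'cV[R]_l) : - N22 *m w = 0 -> Q *m w = 0.
  move=> /eqP; rewrite mulNmx oppr_eq0 => /eqP/kerNM M22w.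
  by rewrite /Q /L mulmxBl -!mulmxA M22w !mulmx0 subr0.
have psdN : psdmx (- N22).
  split; first by apply/symmetricmxP; rewrite linearN /= N22T.
  by move=> x; rewrite -/(bform _ _ _) bformNm oppr_ge0; exact: N22_form.
have [alpha Qalpha] := psd_dominates psdN QT kerNQ.
exists alpha; split.
  by apply/symmetricmxP; rewrite linearB linearZ /= MT NT.
move=> v; rewrite -/(bform _ _ _) -[v]vsubmxK.
move: (usubmx v) (dsubmx v) => x y.
rewrite bformDm bformNm bformZm M_form N_form.
set u := G *m x + y; have -> : y = u - G *m x by rewrite /u addrC addKr.
clearbody u.
have PL_form z : bform P z (L *m u) = bform M22 (G *m z) u.
  by rewrite -bform_mulr PLE bform_mull.
have := Qalpha u; rewrite bformNm /Q bformDm bformNm bform_mulr.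
have P_ge0 z : 0 <= bform P z z.
  have [->|z_neq0] := eqVneq z 0; first by rewrite -(scale0r 0) bformZl mul0r.
  exact/ltW/P_form.
(* The goal is the sum of this square and the slack in [Qalpha u]; the rewriting below expands both
   until they match linearly. *)
have := P_ge0 (x - L *m u).
rewrite bformDl !bformDr !bformNl !bformNr P_formE.
rewrite (bformC (L *m u) x PT) !PL_form !bform_mulr.
rewrite !bformDl !bformNl (bformC u (G *m x) M22T).
rewrite (bformC u (G *m (L *m u)) M22T); lra.
Qed.
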